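(* Let $n\ge1$, $k\in[n]$, $u\in\mathfrak S_n$, and let $\eta\in\mathfrak S_n$ be an $(m+1)$-cycle with $m\ge1$ such that $u\le_k u\eta$. Then there is a unique unimodal path $\gamma$ from $u$ to $u\eta$ in the $k$-Bruhat graph. Moreover $\gamma$ has length $m$ and $\mathrm{de}(\gamma)=\mathrm{ht}_k(\eta)$.
   Context: Bruhat graph: $u\xrightarrow{\tau}w$ if $w=ut_{ab}$ for a transposition with $a<b$, $u(a)<u(b)$, $\tau=u(a)$; a $k$-edge if $a\le k<b$; $u\le_k w$ iff there is a path of $k$-edges from $u$ to $w$. A path with labels $\tau_1,\dots,\tau_m$ is unimodal if $\tau_1<\cdots<\tau_i>\cdots>\tau_m$ for some $1\le i\le m$; then $\mathrm{de}(\gamma)=m-i$. $\mathrm{ht}_k(\eta)=\#\{i\le k:\eta(i)\ne i\}-1$. *)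

(* Defs.v *)
#[warnings="-notation-overridden,-ambiguous-paths"]
From mathcomp Require Import all_boot all_order all_algebra all_fingroup.

Set Implicit Arguments.
Unset Strict Implicit.
Unset Printing Implicit Defensive.

(* MathComp composes permutations left to right, so the functional composite
   u v : i |-> u (v i) is the group product v * u. *)
Definition permcomp n (u v : 'S_n) : 'S_n := (v * u)%g.

Lemma permcompE n (u v : 'S_n) i : permcomp u v i = u (v i).
Proof. exact: permM. Qed.

(* Positions, values and labels are numbered from 0: a : 'I_n stands for a.+1
   in [n], so "a <= k < b" in [n] reads a < k <= b here. The parameter k itself
   is not shifted. *)

Definition bruhat_edge_at n (a b : 'I_n) (u : 'S_n) (tau : 'I_n) (w : 'S_n)
  : bool :=
  [&& a < b, u a < u b, w == permcomp u (tperm a b) & tau == u a].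

Definition bruhat_edge n (u : 'S_n) (tau : 'I_n) (w : 'S_n) : bool :=
  [exists a : 'I_n, exists b : 'I_n, bruhat_edge_at a b u tau w].

Definition k_edge n (k : nat) (u : 'S_n) (tau : 'I_n) (w : 'S_n) : bool :=
  [exists a : 'I_n, exists b : 'I_n,
     (a < k <= b) && bruhat_edge_at a b u tau w].

Lemma k_edge_bruhat n k (u : 'S_n) tau w : k_edge k u tau w -> bruhat_edge u tau w.
Proof.
case/existsP=> a /existsP[b /andP[_ uw]].
by apply/existsP; exists a; apply/existsP; exists b.
Qed.

(* A path starting at u is the list of its steps (label, vertex reached). *)
Definition lpath n := seq ('I_n * 'S_n).

Fixpoint k_path n (k : nat) (u : 'S_n) (g : lpath n) : bool :=
  if g is (tau, v) :: g' then k_edge k u tau v && k_path k v g' else true.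

Definition endpoint n (u : 'S_n) (g : lpath n) : 'S_n := last u (unzip2 g).

Definition k_path_from_to n k (u w : 'S_n) (g : lpath n) : Prop :=
  k_path k u g /\ endpoint u g = w.

Definition k_bruhat_le n k (u w : 'S_n) : Prop :=
  exists g : lpath n, k_path_from_to k u w g.

Definition labels n (g : lpath n) : seq nat := [seq val e.1 | e <- g].

(* s_1 < ... < s_i > ... > s_m with 1 <= i <= m = size s. *)
Definition unimodal_at (i : nat) (s : seq nat) : bool :=
  [&& 0 < i <= size s, sorted ltn (take i s) & sorted gtn (drop i.-1 s)].

Definition unimodal n (g : lpath n) : Prop :=
  exists i, unimodal_at i (labels g).

(* m - i, where i is the peak position (unique by unimodal_at_inj). *)
Definition de n (g : lpath n) : nat :=
  size g - find (fun i => unimodal_at i (labels g)) (iota 0 (size g).+1).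

Definition ht n (k : nat) (eta : 'S_n) : int :=
  (#|[set i : 'I_n | ((i < k)%N) && (eta i != i)]|%:Z - 1)%R.

(* [next c] fixes every element outside c. *)
Definition is_cycle_perm n (l : nat) (eta : 'S_n) : Prop :=
  exists c : seq 'I_n, [/\ uniq c, size c = l & forall x, eta x = next c x].

Definition unimodal_k_path n k (u w : 'S_n) (g : lpath n) : Prop :=
  k_path_from_to k u w g /\ unimodal g.

Lemma unimodal_at_inj i j s : unimodal_at i s -> unimodal_at j s -> i = j.
Proof.
suff lt_false : forall p q, p < q -> unimodal_at p s -> unimodal_at q s -> False.
  move=> si sj; case: (ltngtP i j) => // h.
    by case: (lt_false _ _ h si sj).
  by case: (lt_false _ _ h sj si).
move=> p q lt_pq /and3P[/andP[p0 _] _ dec] /and3P[/andP[q0 qs] inc _].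
have p1 : p.-1.+1 = p by rewrite prednK.
have ps : p < size s := leq_trans lt_pq qs.
have up : nth 0 s p.-1 < nth 0 s p.
  move/(sortedP 0): inc => /(_ p.-1).
  by rewrite p1 size_takel // lt_pq !nth_take // ?(leq_trans _ lt_pq) ?p1 //
    => /(_ isT).
move/(sortedP 0): dec => /(_ 0).
rewrite size_drop !nth_drop addn0 addn1 p1 => /(_ _)/=.
by rewrite ltn_subRL addn1 p1 ps => /(_ isT); rewrite ltnNge ltnW.
Qed.

Lemma deE n (g : lpath n) i : unimodal_at i (labels g) -> de g = size g - i.
Proof.
move=> gi; rewrite /de; congr (_ - _).
set P := fun _ => _; set t := iota _ _.
have ti : i \in t.
  by rewrite mem_iota; case/and3P: gi => /andP[_]; rewrite size_map.
have hasP : has P t by apply/hasP; exists i.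
have lt_find : find P t < (size g).+1 by rewrite -(size_iota 0 (size g).+1) -has_find.
have := nth_find 0 hasP; rewrite nth_iota // add0n => gj.
exact: unimodal_at_inj gj gi.
Qed.

(* Main.v *)
(* A k-edge only moves values at positions a < k up and values at positions
   b >= k down, so along a path from u to u eta the smallest moved value
   p = u a0 is a label, it is the least label, and the edge carrying it swaps
   a0 with b = eta^-1 a0.  In a unimodal path that edge is therefore the first
   or the last one.  If eta a0 <> b, the first position is possible exactly
   when u b < u (eta a0) and the last one exactly when u b > u (eta a0); in
   both cases deleting the edge leaves the same problem for a cycle that is
   one shorter.  Only deleting a last edge changes de, and it lowers both de
   and the height by one. *)
Require Import Defs.
From mathcomp Require Import all_boot all_order all_algebra all_fingroup.

Set Implicit Arguments.
Unset Strict Implicit.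
Unset Printing Implicit Defensive.

(** * Unimodal sequences: adding and removing an end, position of the minimum *)

Lemma gtn_trans : transitive gtn.
Proof. by move=> y x z /= yx zy; apply: ltn_trans zy yx. Qed.

Lemma unimodal_at_cons i x s :
  unimodal_at i s -> all (ltn x) s -> unimodal_at i.+1 (x :: s).
Proof.
case: i => [|i] /and3P[// i_s inc dec] xs; apply/and3P; split=> //.
rewrite (sorted_pairwise ltn_trans) /= -(sorted_pairwise ltn_trans) inc andbT.
by apply/allP=> y /mem_take /(allP xs).
Qed.

Lemma unimodal_at_rcons i x s :
  unimodal_at i s -> all (ltn x) s -> unimodal_at i (rcons s x).
Proof.
case/and3P=> /andP[i0 i_s] inc dec xs; rewrite /unimodal_at size_rcons i0 leqW //.
rewrite -cats1 takel_cat // inc cats1 drop_rcons; last first.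
  by rewrite (leq_trans (leq_pred _)).
rewrite (sorted_pairwise gtn_trans) pairwise_rcons -(sorted_pairwise gtn_trans).
by rewrite dec !andbT; apply/allP=> y /mem_drop /(allP xs).
Qed.

Lemma unimodal_at_behead (i x : nat) (s : seq nat) :
  s != [::] -> unimodal_at i (x :: s) -> exists j, unimodal_at j s.
Proof.
(* If the peak is the removed entry [x], all of [y :: s] descends and its new peak is [y], at
   position 1. Otherwise the peak shifts by one. *)
case: s => [//|y s] _; case: i => [|[|i]] /and3P[// i_s inc dec].
  exists 1; rewrite /unimodal_at /= take0 /=.
  by move: dec => /= /andP[].
exists i.+1; rewrite /unimodal_at dec andbT; apply/andP; split=> //.
by move: inc => /= /andP[].
Qed.

Lemma unimodal_at_belast (i x : nat) (s : seq nat) :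
  s != [::] -> unimodal_at i (rcons s x) -> exists j, unimodal_at j s.
Proof.
rewrite -size_eq0 -lt0n => s0 /and3P[]; rewrite size_rcons => /andP[i0 i_s] inc.
rewrite (sorted_pairwise gtn_trans).
move: i_s; rewrite leq_eqVlt => /orP[/eqP ei _|].
  (* Here the peak is the removed last entry, so [s] increases and its own last entry becomes the
     peak; the descending part is a singleton. *)
  exists (size s); rewrite /unimodal_at s0 leqnn take_size /=; apply/andP; split.
    move: inc; rewrite ei -(size_rcons s x) take_size.
    by rewrite !(sorted_pairwise ltn_trans) pairwise_rcons => /andP[].
  have: size (drop (size s).-1 s) = 1.
    by rewrite size_drop; case: (s) s0 => //= y t _; rewrite subSnn.
  by case: (drop _ s) => [|y [|z t]].
rewrite ltnS => i_s; rewrite drop_rcons ?(leq_trans (leq_pred _)) //.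
rewrite pairwise_rcons -(sorted_pairwise gtn_trans) => /andP[_ dec].
exists i; rewrite /unimodal_at i0 i_s dec andbT.
by move: inc; rewrite -cats1 takel_cat // => ->.
Qed.

(** Cut just before the peak: a minimum in the increasing part must be its first entry, and a
    minimum in the decreasing part must be its last. *)
Lemma unimodal_at_min i x s :
  unimodal_at i s -> x \in s -> all (leq x) s -> head x s = x \/ last x s = x.
Proof.
case: i => [|i] /and3P[// _ inc dec] xs /allP le_xs.
move: xs; rewrite -{1}(cat_take_drop i s) mem_cat => /orP[xs | xs].
  left; case: s {dec} inc xs le_xs => [//|y s].
  rewrite (sorted_pairwise ltn_trans) /= => /andP[/allP lt_ys _].
  case: i lt_ys => [//|i] lt_ys; rewrite inE => /orP[/eqP-> // | xs] le_xs.
  have /lt_ys /= : x \in take i.+1 s.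
    rewrite -(cat_take_drop i (take i.+1 s)) take_takel //.
    by rewrite mem_cat xs.
  by rewrite ltnNge le_xs ?mem_head.
right; have -> : last x s = last x (drop i s).
  by case: (drop i s) (cat_take_drop i s) xs => [//|y t] <- _; rewrite last_cat.
have {}le_xs y : y \in drop i s -> x <= y by move/mem_drop; apply: le_xs.
move: dec; rewrite /= (sorted_pairwise gtn_trans).
case/lastP: (drop i s) xs le_xs => [//|t y]; rewrite mem_rcons inE last_rcons.
case/orP=> [/eqP-> // | xt] le_xs.
rewrite pairwise_rcons => /andP[/allP /(_ _ xt) /= lt_yx _].
by move: lt_yx; rewrite ltnNge le_xs // mem_rcons mem_head.
Qed.

(** * Shortening a cycle by a transposition *)

Lemma next_at_out (T : eqType) (x y0 y : T) s :
  x != y -> x \notin s -> next_at x y0 y s = x.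
Proof.
elim: s y => [|z s IH] y /= /negPf-> //.
by rewrite inE negb_or => /andP[]; apply: IH.
Qed.

(** Applying the transposition after the cycle redirects to [a] the arrow that entered [b], and [b]
    becomes fixed. *)
Lemma next_skip_head (T : finType) (a b : T) s : uniq (b :: a :: s) ->
  forall x, tperm a b (next (b :: a :: s) x) = next (a :: s) x.
Proof.
rewrite /= inE negb_or => /and3P[/andP[ba bs] as_ us] x.
(* The current element [y] is generalized for the induction; the transposition only changes the
   wrap-around value from [b] to [a]. *)
have aux y t : x != a -> x != b -> a \notin t -> b \notin t ->
    tperm a b (next_at x b y t) = next_at x a y t.
  move=> xa xb; elim: t y => [|z t IH] y /=.
    by case: eqP => _ _ _; rewrite ?tpermR ?tpermD 1?eq_sym.
  rewrite !inE !negb_or => /andP[az aT] /andP[bz bt].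
  by case: eqP => _; rewrite ?IH ?tpermD // 1?eq_sym.
have [-> | xb] := eqVneq x b.
  by rewrite tpermL next_at_out.
have [-> | xa] := eqVneq x a; last by apply: aux.
case: s bs as_ us {aux} => [|z s] /=; rewrite ?eqxx ?tpermR //.
rewrite !inE !negb_or => /andP[bz _] /andP[az _] _.
by rewrite tpermD // eq_sym.
Qed.

(** Applying the transposition before the cycle makes [b] follow the arrow that left [a], and [a]
    becomes fixed. *)
Lemma next_skip_second (T : finType) (a b : T) s : uniq (b :: a :: s) ->
  forall x, next (b :: a :: s) (tperm a b x) = next (b :: s) x.
Proof.
rewrite /= inE negb_or => /and3P[/andP[ba bs] as_ us] x.
case: tpermP => [-> | -> | xa xb].
- by rewrite eqxx next_at_out // eq_sym.
- rewrite eq_sym (negPf ba); case: s {bs as_ us} => [|z s] /=; by rewrite !eqxx.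
- have/eqP/negPf xbF := xb; have/eqP/negPf xaF := xa.
  by rewrite xbF; case: s {bs as_ us} => [|z s] /=; rewrite xaF xbF.
Qed.

(** * Paths of k-edges and bounds on their labels *)

Section KBruhatPaths.

Variables n k : nat.
Implicit Types (u v w eta : 'S_n) (g : lpath n).

Lemma k_edgeP u (tau : 'I_n) v :
  reflect (exists a b : 'I_n, [/\ a < k <= b, u a < u b,
                                   v = permcomp u (tperm a b) & tau = u a])
          (k_edge k u tau v).
Proof.
apply: (iffP existsP) => [[a /existsP[b /andP[kab]]] | [a [b [kab uab -> ->]]]].
  by case/and4P=> _ uab /eqP-> /eqP->; exists a, b.
exists a; apply/existsP; exists b; rewrite kab /bruhat_edge_at uab !eqxx.
by case/andP: kab => ak kb; rewrite (leq_trans ak kb).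
Qed.

(** A consequence of [u] being below [w] in k-Bruhat order. It replaces the existence of a path in
    the induction, since it can be checked directly after an edge is deleted. *)
Definition lifted u w :=
  forall a : 'I_n, if a < k then u a <= w a else w a <= u a.

Lemma lifted_lo u w (a : 'I_n) : lifted u w -> a < k -> u a <= w a.
Proof. by move=> /(_ a) + ak; rewrite ak. Qed.

Lemma lifted_hi u w (b : 'I_n) : lifted u w -> k <= b -> w b <= u b.
Proof. by move=> /(_ b) + kb; rewrite ltnNge kb. Qed.

Lemma lifted_trans v u w : lifted u v -> lifted v w -> lifted u w.
Proof.
move=> uv vw a; case: ltnP => ak.
  exact: leq_trans (lifted_lo uv ak) (lifted_lo vw ak).
exact: leq_trans (lifted_hi vw ak) (lifted_hi uv ak).
Qed.

Lemma k_edge_lifted u tau v : k_edge k u tau v -> lifted u v.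
Proof.
case/k_edgeP=> a [b [/andP[ak kb] uab -> _]] x; rewrite permcompE.
case: tpermP => [-> | -> | _ _]; rewrite ?ak ?leqnn ?if_same ?(ltnW uab) //.
by rewrite ltnNge kb.
Qed.

Lemma k_path_lifted u w g : k_path_from_to k u w g -> lifted u w.
Proof.
case; elim: g u => [|[tau v] g IH] u /=.
  by move=> _ <- a; rewrite leqnn if_same.
by case/andP=> /k_edge_lifted uv gv gw; apply: lifted_trans uv (IH _ gv gw).
Qed.

Lemma k_path_from_to_cons u v w tau g :
  k_path_from_to k u w ((tau, v) :: g) <->
  k_edge k u tau v /\ k_path_from_to k v w g.
Proof.
rewrite /k_path_from_to /=; split=> [[/andP[e p] q] | [e [p q]]] //.
by rewrite e.
Qed.

Lemma k_path_from_to_rcons u w w' tau g :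
  k_path_from_to k u w (rcons g (tau, w')) <->
  [/\ w' = w, k_edge k (endpoint u g) tau w & k_path k u g].
Proof.
rewrite /k_path_from_to; elim: g u => [|[t v] g IH] u /=.
  rewrite /endpoint /= andbT; split=> [[e <-] //|[-> e _] //].
split=> [[/andP[e p] q] | [ew e /andP[e' p]]].
  by have [ew e' p'] := (IH v).1 (conj p q); split; rewrite //= e.
by have [p' q] := (IH v).2 (And3 ew e p); split; rewrite //= e'.
Qed.

(** The witnesses are the two positions swapped by the edge labelled [l]. Their values move
    monotonically along the path, so the bounds at that edge extend to both ends. *)
Lemma k_path_label u w g l : k_path_from_to k u w g -> l \in labels g ->
  (exists2 a : 'I_n, a < k & u a <= l < w a) /\
  (exists2 b : 'I_n, k <= b & w b <= l < u b).
Proof.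
elim: g u => [//|[tau v] g IH] u /k_path_from_to_cons[uv vw].
have Lvw := k_path_lifted vw; have Luv := k_edge_lifted uv.
rewrite inE => /orP[/eqP-> | /(IH _ vw)[[a ak /andP[va aw]] [b kb /andP[wb bv]]]].
  case/k_edgeP: uv Luv => a [b [/andP[ak kb] uab def_v ->]] Luv /=.
  split; [exists a | exists b] => //.
    rewrite leqnn (leq_trans uab) // (leq_trans _ (lifted_lo Lvw ak)) //.
    by rewrite def_v permcompE tpermL.
  rewrite uab andbT (leq_trans (lifted_hi Lvw kb)) //.
  by rewrite def_v permcompE tpermR.
split; [exists a | exists b] => //.
  by rewrite aw andbT (leq_trans (lifted_lo Luv ak)).
by rewrite wb (leq_trans bv (lifted_hi Luv kb)).
Qed.

(** Position [a] keeps its value until the first edge that uses it. Since [a < k], it is the left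
    position of that edge, whose label is therefore [u a]. *)
Lemma mem_k_path_label u w g (a : 'I_n) :
  k_path_from_to k u w g -> a < k -> u a != w a -> val (u a) \in labels g.
Proof.
move=> + ak; elim: g u => [|[tau v] g IH] u.
  by rewrite /k_path_from_to /endpoint /= => -[_ ->]; rewrite eqxx.
case/k_path_from_to_cons=> /k_edgeP[c [b [/andP[ck kb] _ def_v ->]]] vw uw.
rewrite inE /=; have [-> // | ca] := eqVneq c a; first by rewrite eqxx.
have eva : v a = u a.
  rewrite def_v permcompE tpermD // ?ca //; apply/eqP=> ba.
  by move: ak; rewrite -ba ltnNge kb.
by rewrite -eva IH ?orbT // eva.
Qed.

(** The label of a first edge would lie in an empty interval from [u a] to [u a]. *)
Lemma k_path_loop u g : k_path_from_to k u u g -> g = [::].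
Proof.
case: g => [//|[tau v] g] p.
have [|[a _ /andP[ua au]] _] := k_path_label p (l := val tau).
  by rewrite mem_head.
by move: (leq_ltn_trans ua au); rewrite ltnn.
Qed.

(** * Cycle permutations and their shortening *)

Lemma is_cycle_perm2 eta a b : is_cycle_perm 2 eta -> a != b -> eta b = a ->
  eta = tperm a b.
Proof.
case=> c [uc sc]; case: c sc uc => [|x [|y []]] //= _.
rewrite inE andbT => xy eE ab eb.
have eE' : eta = tperm x y.
  apply/permP=> z; rewrite eE /=; case: tpermP => [-> | -> | /eqP zx /eqP zy].
  - by rewrite eqxx.
  - by rewrite eqxx eq_sym (negPf xy).
  - by rewrite (negPf zx) (negPf zy).
move: eb; rewrite eE'; case: tpermP => [-> -> | -> -> // | _ _ ba].
  by rewrite tpermC.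
by rewrite ba eqxx in ab.
Qed.

Lemma is_cycle_perm_moved m eta :
  is_cycle_perm m.+2 eta -> exists a, eta a != a.
Proof.
case=> c [uc sc]; case: c sc uc => [|x [|y c]] //= _ /andP[+ _] eE.
rewrite inE negb_or => /andP[xy _].
by exists x; rewrite eE /= eqxx eq_sym.
Qed.

(** Rotating the list to start at [b] puts [a], the image of [b], second, as the shortening lemmas
    require. *)
Lemma is_cycle_perm_from m eta a b : is_cycle_perm m.+1 eta -> a != b ->
  eta b = a ->
  exists s, [/\ uniq (b :: a :: s), size (b :: a :: s) = m.+1
              & forall x, eta x = next (b :: a :: s) x].
Proof.
case=> c [uc sc eE] ab eb.
have bc : b \in c.
  by apply: contraNT ab => bc; rewrite -eb eE next_nth (negPf bc).
have [i t rt] := rot_to bc.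
have eE' x : eta x = next (b :: t) x by rewrite -rt next_rot.
have ut : uniq (b :: t) by rewrite -rt rot_uniq.
have st : size (b :: t) = m.+1 by rewrite -rt size_rot.
case: t {rt} eE' ut st => [|y t] eE' ut st.
  by move: eb ab; rewrite eE' /= eqxx => ->; rewrite eqxx.
have ya : y = a by rewrite -eb eE' /= eqxx.
by exists t; rewrite -ya.
Qed.

Lemma is_cycle_perm_skip_head m eta a b : is_cycle_perm m.+2 eta -> a != b ->
  eta b = a -> is_cycle_perm m.+1 (permcomp (tperm a b) eta).
Proof.
move=> ce ab eb; have [s [us [ss] eE]] := is_cycle_perm_from ce ab eb.
exists (a :: s); split; [by case/andP: us | by rewrite /= ss |].
by move=> x; rewrite permcompE eE next_skip_head.
Qed.

Lemma is_cycle_perm_skip_second m eta a b : is_cycle_perm m.+2 eta -> a != b ->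
  eta b = a -> is_cycle_perm m.+1 (permcomp eta (tperm a b)).
Proof.
move=> ce ab eb; have [s [us [ss] eE]] := is_cycle_perm_from ce ab eb.
exists (b :: s); split; [|by rewrite /= ss|].
  by move: us; rewrite /= inE negb_or -andbA => /and4P[_ -> _ ->].
by move=> x; rewrite permcompE eE next_skip_second.
Qed.

Lemma moved_min m u eta : is_cycle_perm m.+2 eta ->
  exists2 a, eta a != a & forall x, eta x != x -> u a <= u x.
Proof.
move/is_cycle_perm_moved=> [a0 ea0].
case: (@arg_minnP _ a0 (fun x => eta x != x) (fun x => val (u x)) ea0).
by move=> a ea mina; exists a.
Qed.

(** * The edge carrying the smallest moved value, at either end of the path *)

Section Peel.

Variables (u eta : 'S_n) (a b : 'I_n).
Let w := permcomp u eta.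
Hypothesis uw : lifted u w.
Hypothesis ea : eta a != a.
Hypothesis a_min : forall x, eta x != x -> u a <= u x.
Hypothesis eb : eta b = a.

Let ab : a != b. Proof. by apply: contraNneq ea => {1}->; rewrite eb. Qed.

Let moved_eta x : eta x != x -> eta (eta x) != eta x.
Proof. by rewrite (inj_eq perm_inj). Qed.

Let eb_b : eta b != b. Proof. by rewrite eb. Qed.

Let w_b : w b = u a. Proof. by rewrite permcompE eb. Qed.

Let min_lt x : eta x != x -> x != a -> u a < u x.
Proof.
move=> ex xa; rewrite ltn_neqAle a_min // andbT eq_sym.
by apply: contraNneq xa => /val_inj/perm_inj->.
Qed.

(** Otherwise [w a <= u a], while [w a] is the value of [u] at the moved position [eta a], hence
    larger than the minimum [u a]. *)
Lemma min_lo : a < k.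
Proof.
rewrite ltnNge; apply/negP=> /(lifted_hi uw).
by rewrite permcompE leqNgt min_lt // moved_eta.
Qed.

Lemma min_pre_hi : k <= b.
Proof.
rewrite leqNgt; apply/negP=> /(lifted_lo uw).
by rewrite w_b leqNgt min_lt // eq_sym.
Qed.

Lemma min_lt_pre : u a < u b. Proof. by rewrite min_lt // eq_sym. Qed.

(** The inner neighbours of the two ends: [ut] follows [u] if the edge comes first, [wt] precedes
    [w] if it comes last. *)
Let ut := permcomp u (tperm a b).
Let wt := permcomp w (tperm a b).

Lemma first_edge : k_edge k u (u a) ut.
Proof. by apply/k_edgeP; exists a, b; rewrite min_lo min_pre_hi min_lt_pre. Qed.

Lemma wtE : wt = permcomp u (permcomp eta (tperm a b)).
Proof. by apply/permP=> x; rewrite !permcompE. Qed.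

Lemma utE : w = permcomp ut (permcomp (tperm a b) eta).
Proof. by apply/permP=> x; rewrite !permcompE tpermK. Qed.

Lemma wt_a : wt a = u a. Proof. by rewrite permcompE tpermL. Qed.

Lemma ut_b : ut b = u a. Proof. by rewrite permcompE tpermR. Qed.

Lemma last_edge : k_edge k wt (u a) w.
Proof.
apply/k_edgeP; exists a, b; rewrite min_lo min_pre_hi wt_a; split=> //.
  rewrite permcompE tpermR permcompE min_lt //; exact: moved_eta.
by apply/permP=> x; rewrite !permcompE tpermK.
Qed.

(** The label fixes the left position. The right position [b'] drops to [u a] and cannot rise again,
    so by minimality [w b' = u a], which forces [b' = b]. *)
Lemma first_edge_eq v : k_edge k u (u a) v -> lifted v w -> v = ut.
Proof.
case/k_edgeP=> a' [b' [/andP[_ kb] + -> /perm_inj aa']].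
rewrite -{}aa' => uab vw.
have := lifted_hi vw kb; rewrite permcompE tpermR => wb'.
have eb' : eta b' != b'.
  apply: contraTneq (leq_ltn_trans wb' uab) => eb'.
  by rewrite permcompE eb' ltnn.
have/eqP: val (w b') = u a.
  by apply/eqP; rewrite eqn_leq wb' permcompE a_min // moved_eta.
rewrite permcompE => /eqP/val_inj/perm_inj eb'a.
by rewrite (perm_inj (etrans eb'a (esym eb))).
Qed.

(** The right position ends at [u a = w b], so it is [b]. The left one, [a'], satisfies
    [u a' <= v a' = u a] and is moved by [eta], so minimality gives [a' = a]. *)
Lemma last_edge_eq v : k_edge k v (u a) w -> lifted u v -> v = wt.
Proof.
case/k_edgeP=> a' [b' [/andP[ak kb] vab def_w ua]] uv.
have eb' : b' = b.
  by apply: (@perm_inj _ w); rewrite w_b {1}def_w permcompE tpermR.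
have ea' : a' = a.
  apply: (@perm_inj _ u); apply/val_inj/eqP; rewrite eqn_leq.
  have := lifted_lo uv ak; rewrite -ua => le_a'; rewrite le_a' /= a_min //.
  apply: contraTneq le_a' => ea'; rewrite -ltnNge.
  have: w a' = v b' by rewrite {1}def_w permcompE tpermL.
  by rewrite permcompE ea' => ->; rewrite ua.
by apply/permP=> x; rewrite /wt def_w ea' eb' !permcompE tpermK.
Qed.

(** Only positions [a] and [b] change. At [b] the value is already final; at [a] the inequality is
    exactly the assumption. *)
Lemma first_lifted : u b <= u (eta a) -> lifted ut w.
Proof.
move=> ub x; have := uw x; rewrite [ut x]permcompE.
case: tpermP => [-> | -> | //].
  by rewrite min_lo permcompE.
by rewrite ltnNge min_pre_hi /= w_b leqnn.
Qed.

Lemma last_lifted : u (eta a) <= u b -> lifted u wt.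
Proof.
move=> ub x; have := uw x; rewrite [wt x]permcompE.
case: tpermP => [-> | -> | //].
  by rewrite min_lo w_b.
by rewrite ltnNge min_pre_hi /= [w a]permcompE.
Qed.

Lemma first_lifted_le : lifted ut w -> u b <= u (eta a).
Proof. by move/lifted_lo/(_ min_lo); rewrite !permcompE tpermL. Qed.

Lemma last_lifted_le : lifted u wt -> u (eta a) <= u b.
Proof. by move/lifted_hi/(_ min_pre_hi); rewrite !permcompE tpermR. Qed.

(** A label is at least [w c] for some high position [c] that still moves. As [c] is not [b], where
    [u a] already sits, [w c] exceeds [u a]. *)
Lemma first_labels g : k_path_from_to k ut w g -> all (ltn (u a)) (labels g).
Proof.
move=> gw; apply/allP=> l /(k_path_label gw)[_ [c kc /andP[wc cu]]] /=.
have ca : c != a by apply: contraTneq kc => ->; rewrite -ltnNge min_lo.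
have cb : c != b.
  apply: contraTneq (leq_ltn_trans wc cu) => ->.
  by rewrite w_b ut_b ltnn.
apply: leq_trans (wc); rewrite permcompE min_lt //; last first.
  by rewrite -eb (inj_eq perm_inj).
apply: moved_eta; apply: contraTneq (leq_ltn_trans wc cu) => ec.
by rewrite !permcompE ec tpermD ?ltnn // eq_sym.
Qed.

Lemma last_labels g : k_path_from_to k u wt g -> all (ltn (u a)) (labels g).
Proof.
move=> gw; apply/allP=> l /(k_path_label gw)[[c kc /andP[uc cw]] _] /=.
have cb : c != b by apply: contraTneq kc => ->; rewrite -leqNgt min_pre_hi.
have ca : c != a.
  apply: contraTneq (leq_ltn_trans uc cw) => ->.
  by rewrite wt_a ltnn.
apply: leq_trans (uc); rewrite min_lt //.
apply: contraTneq (leq_ltn_trans uc cw) => ec.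
by rewrite !permcompE tpermD ?ec ?ltnn // eq_sym.
Qed.

Lemma path_labels_min g : k_path_from_to k u w g -> all (leq (u a)) (labels g).
Proof.
move=> gw; apply/allP=> l /(k_path_label gw)[[c kc /andP[uc cw]] _] /=.
apply: leq_trans (uc); apply: a_min.
apply: contraTneq (leq_ltn_trans uc cw) => ec.
by rewrite permcompE ec ltnn.
Qed.

Lemma unimodal_k_path_cases g : unimodal_k_path k u w g ->
  (exists2 g', g = (u a, ut) :: g' & k_path_from_to k ut w g') \/
  (exists2 g', g = rcons g' (u a, w) & k_path_from_to k u wt g').
Proof.
case=> gw [i gi]; have le_g := path_labels_min gw.
have ug : val (u a) \in labels g.
  apply: (mem_k_path_label gw min_lo).
  by rewrite permcompE (inj_eq perm_inj) eq_sym.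
case: (unimodal_at_min gi ug le_g) => {gi le_g}.
  case: g gw ug => [//|[tau v] g] /k_path_from_to_cons[uv vw] _ /= /val_inj tu.
  rewrite tu in uv *; have ev := first_edge_eq uv (k_path_lifted vw).
  by left; exists g; rewrite -?ev.
elim/last_ind: g gw ug => [//|g [tau v] _] /k_path_from_to_rcons[-> vw ug] _.
rewrite /labels map_rcons last_rcons /= => /val_inj tu.
right; exists g; first by rewrite tu.
rewrite tu in vw; split=> //; apply: last_edge_eq vw _.
exact: k_path_lifted (conj ug erefl).
Qed.

End Peel.

(** * Change of the height, and induction on the cycle length *)

Lemma card_moved_first eta (a b : 'I_n) :
  a < k -> k <= b -> eta a != a -> eta a != b ->
  #|[set i : 'I_n | (i < k) && (permcomp (tperm a b) eta i != i)]| =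
  #|[set i : 'I_n | (i < k) && (eta i != i)]|.
Proof.
move=> ak kb ea eab; apply: eq_card => i; rewrite !inE permcompE.
case: ltnP => //= ik; rewrite -(inj_eq (@perm_inj _ (tperm a b))) tpermK.
(* [a] stays moved because [eta a] is not [b]; the newly fixed [b] is not counted, being at least
   [k]. *)
case: (tpermP a b i) => [-> | ib | //]; first by rewrite ea eab.
by move: ik; rewrite ib ltnNge kb.
Qed.

Lemma card_moved_last eta (a b : 'I_n) :
  a < k -> k <= b -> eta a != a -> eta b = a ->
  #|[set i : 'I_n | (i < k) && (eta i != i)]| =
  #|[set i : 'I_n | (i < k) && (permcomp eta (tperm a b) i != i)]|.+1.
Proof.
move=> ak kb ea eb.
rewrite (cardsD1 a) inE ak ea add1n; congr _.+1; apply: eq_card => i.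
rewrite !inE permcompE; case: (tpermP a b i) => [-> | -> | /eqP/negPf-> //].
  by rewrite eb eqxx andbF.
by rewrite !(ltnNge _ k) kb andbF.
Qed.

(** Assuming only [lifted] lets the induction hypothesis apply to the shortened cycle, and it then
    supplies the rest of the path. *)
Theorem unimodal_k_path_unique m u eta : is_cycle_perm m.+2 eta ->
  lifted u (permcomp u eta) ->
  exists g, [/\ unique (unimodal_k_path k u (permcomp u eta)) g, size g = m.+1
    & #|[set i : 'I_n | (i < k) && (eta i != i)]| = (de g).+1].
Proof.
elim: m u eta => [|m IH] u eta ce uw.
all: have [a ea a_min] := moved_min u ce.
all: pose b := (eta^-1)%g a; have eb : eta b = a by rewrite permKV.
all: have ab : a != b by apply: contraNneq ea => {1}->; rewrite eb.
all: have ak := min_lo uw ea a_min; have kb := min_pre_hi uw ea a_min eb.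
all: have e_first := first_edge uw ea a_min eb.
all: have e_last := last_edge uw ea a_min eb.
all: have cases := unimodal_k_path_cases uw ea a_min eb.
  (* For a 2-cycle [eta] is the swap itself, so either way of deleting the edge leaves a loop, hence
     the empty path. *)
  have eE := is_cycle_perm2 ce ab eb; rewrite -eE in e_first cases e_last.
  have wE : permcomp (permcomp u eta) eta = u.
    by apply/permP=> x; rewrite !permcompE eE tpermK.
  exists [:: (u a, permcomp u eta)]; split=> //.
    split.
      by split; [split=> //=; rewrite e_first | exists 1].
    move=> g /cases[[g' -> /k_path_loop-> //] | [g' ->]].
    by rewrite wE => /k_path_loop->.
  rewrite (@deE _ _ 1) //= (cardsD1 a) inE ak ea eE.
  rewrite [X in _ + X](_ : _ = 0) //; apply/eqP; rewrite cards_eq0.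
  apply/eqP/setP=> i; rewrite !inE; case: tpermP => [->|->|_ _].
  - by rewrite eqxx.
  - by rewrite ltnNge kb andbF.
  - by rewrite eqxx !andbF.
(* The cycle now has length at least 3, so its list has an entry after [b] and [a]. *)
have eab : eta a != b.
  have [[|z s] [us ss eE]] := is_cycle_perm_from ce ab eb; first by [].
  rewrite eE /= (negPf ab) eqxx; apply: contraTneq us => ->.
  by rewrite /= !inE eqxx orbT.
(* This and [ne_wt] make the remaining path nonempty; the empty path is not unimodal, so the
   induction hypothesis could not be applied to it. *)
have ne_ut : permcomp u (tperm a b) <> permcomp u eta.
  move/permP/(_ a); rewrite !permcompE tpermL => /perm_inj eab'.
  by rewrite -eab' eqxx in eab.
have ne_wt : u <> permcomp (permcomp u eta) (tperm a b).
  move/permP/(_ b); rewrite !permcompE tpermR => /perm_inj eab'.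
  by rewrite -eab' eqxx in eab.
have ne_u : u b != u (eta a) by rewrite (inj_eq perm_inj) eq_sym.
have unimodal_tail t g : g <> [::] -> unimodal (t :: g) -> unimodal g.
  by case: g => [//|e g] _ [i] /unimodal_at_behead; apply.
have unimodal_init t g : g <> [::] -> unimodal (rcons g t) -> unimodal g.
  case: g => [//|e g] _ [i]; rewrite /labels map_rcons.
  by move/unimodal_at_belast; apply.
have [lt_b | lt_b | /val_inj/eqP] := ltngtP (u b) (u (eta a)); last first.
- by rewrite (negPf ne_u).
- have uw' := last_lifted uw ea a_min eb (ltnW lt_b).
  have ce' := is_cycle_perm_skip_second ce ab eb.
  move: (IH u _ ce'); rewrite -wtE => /(_ uw')[g [[[gw [i gi]] g_uniq] sg hg]].
  have gi' : unimodal_at i (labels (rcons g (u a, permcomp u eta))).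
    rewrite /labels map_rcons; apply: unimodal_at_rcons gi _.
    exact: last_labels gw.
  exists (rcons g (u a, permcomp u eta)); split.
  + split.
      split; last by exists i.
      by apply/k_path_from_to_rcons; case: gw => gk ->.
    move=> g1 g1w; case: (cases _ g1w) => -[g' eg1 g'w].
      (* A competing path with the edge first would force the opposite comparison of [u b] and
         [u (eta a)]. *)
      have /k_path_lifted := g'w; move/(first_lifted_le uw ea a_min).
      by rewrite leqNgt lt_b.
    rewrite eg1; congr rcons; apply: g_uniq; split=> //.
    apply: (unimodal_init (u a, permcomp u eta)); last by case: g1w; rewrite eg1.
    by move=> g'0; case: g'w; rewrite g'0 => _ /ne_wt.
  + by rewrite size_rcons sg.
  + rewrite (card_moved_last ak kb ea eb) hg (deE gi) (deE gi') size_rcons.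
    (* The length grows while the peak stays at [i]; the truncated subtraction needs
       [i <= size g]. *)
    by rewrite subSn //; case/and3P: gi => /andP[_]; rewrite size_map.
- have uw' := first_lifted uw ea a_min eb (ltnW lt_b).
  have ce' := is_cycle_perm_skip_head ce ab eb.
  move: (IH (permcomp u (tperm a b)) _ ce'); rewrite -utE.
  move=> /(_ uw')[g [[[gw [i gi]] g_uniq] sg hg]].
  have gi' : unimodal_at i.+1 (labels ((u a, permcomp u (tperm a b)) :: g)).
    apply: unimodal_at_cons gi _; exact: first_labels gw.
  exists ((u a, permcomp u (tperm a b)) :: g); split.
  + split.
      split; last by exists i.+1.
      by apply/k_path_from_to_cons.
    move=> g1 g1w; case: (cases _ g1w) => -[g' eg1 g'w]; last first.
      have /k_path_lifted := g'w; move/(last_lifted_le uw ea a_min eb).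
      by rewrite leqNgt lt_b.
    rewrite eg1; congr cons; apply: g_uniq; split=> //.
    apply: (unimodal_tail (u a, permcomp u (tperm a b))).
      by move=> g'0; case: g'w; rewrite g'0 => _ /ne_ut.
    by case: g1w; rewrite eg1.
  + by rewrite /= sg.
  (* Length and peak position both grow by one, so [de] is unchanged. *)
  + by rewrite -(card_moved_first ak kb ea eab) hg (deE gi) (deE gi').
Qed.

End KBruhatPaths.

Theorem theorem6p3 (n k : nat) (hn : 1 <= n) (hk : 1 <= k <= n)
    (u eta : 'S_n) (m : nat) (hm : 1 <= m)
    (heta : is_cycle_perm m.+1 eta)
    (hle : k_bruhat_le k u (permcomp u eta)) :
  exists g : lpath n,
    [/\ unique (unimodal_k_path k u (permcomp u eta)) g,
        size g = m
      & Posz (de g) = ht k eta].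
Proof.
case: hle => g0 /k_path_lifted uw.
case: m hm heta => [//|m] _ heta.
have [g [g_uniq sg hg]] := unimodal_k_path_unique heta uw.
by exists g; split; rewrite // /ht hg -addn1 PoszD GRing.addrK.
Qed.
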